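(* The function $\theta(x)=\sqrt[x]{2\zeta(x)\Gamma(x+1)}=\bigl(2\zeta(x)\Gamma(x+1)\bigr)^{1/x}$ is log-concave on the interval $(6,\infty)$.
   Context: Here $x$ is a real variable, $\zeta(x)=\sum_{n=1}^{\infty}\frac{1}{n^x}$ (for $x>1$) is the Riemann zeta function and $\Gamma$ is the Gamma function. A positive function $f$ on an interval is log-concave if $\log f$ is concave on that interval. *)

(* Defs.v *)
From Stdlib Require Import Reals.
From Coquelicot Require Import Coquelicot.
Open Scope R_scope.

(* [Series] starts at index 0, hence the shift; meaningful for x > 1. *)
Definition zeta (x : R) : R :=
  Series (fun n : nat => 1 / Rpower (INR (S n)) x).

(* Euler's integral over (0, +oo), improper at both ends; meaningful for x > 0. *)
Definition Gamma (x : R) : R :=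
  RInt_gen (fun t : R => Rpower t (x - 1) * exp (- t))
    (at_right 0) (Rbar_locally p_infty).

(* [Rpower a b] is [exp (b * ln a)], the usual real power for a > 0. *)
Definition theta (x : R) : R :=
  Rpower (2 * zeta x * Gamma (x + 1)) (1 / x).

Definition concave_on (I : R -> Prop) (f : R -> R) : Prop :=
  forall x y t : R, I x -> I y -> 0 <= t <= 1 ->
    t * f x + (1 - t) * f y <= f (t * x + (1 - t) * y).

Definition log_concave_on (I : R -> Prop) (f : R -> R) : Prop :=
  (forall x : R, I x -> 0 < f x) /\ concave_on I (fun x => ln (f x)).

(* Main.v *)
Require Import Defs.
From Stdlib Require Import Reals Lra Lia.
From Coquelicot Require Import Coquelicot.
Open Scope R_scope.

(** Write L(s) for the logarithm of Gamma(s + 1).  Since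
      ln (theta x) = (ln 2 + ln (zeta x) + L(x)) / x,
    the point is to exhibit the right-hand side as a pointwise limit of
    functions h(x) / x whose concavity can be read off two derivatives: h / x
    is concave on a positive ray as soon as x^2 h'' - 2 x h' + 2 h <= 0 there
    ([concave_on_quotient]), an expression linear in h.

    Gamma is never differentiated.  Convexity of L and its functional equation
    give, as in the Bohr-Mollerup theorem, the Gauss product in the form
      L(x) / x = lim_n ( ln n - sum_(k <= n) ln (1 + x / k) / x )
    ([lnGamma_limit]).  Each - ln (1 + x / k) / x is itself concave on x > 0
    ([concave_on_log_factor]), so L(x) / x is concave and only the terms
    (ln 2 + ln (zeta x)) / x, which bend the wrong way, must be compensated.

    The first three factors of the product suffice for this.  The expression
    above, for h = - ln (1 + x / k), decreases in x, so it is at most its value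
    at x = 6; for k = 1, 2, 3 together with h = ln 2 these values sum to
    about -1.186.  Replacing zeta by a partial sum Z keeps the derivatives
    elementary, and there the contribution of ln Z is at most
      sum_(n >= 2) q(x ln n),   q(y) = (y^2 + 2 y + 2) exp (- y),
    which is at most 0.9 for every x >= 6 and every length of the partial sum
    ([ln_zeta_curv_le]).  Taking partial sums and partial products of growing
    length yields concave approximants of ln theta on (6, oo). *)

(** * Concavity from derivatives *)

Lemma concave_on_ext (I : R -> Prop) (f g : R -> R) :
  (forall x, I x -> f x = g x) ->
  (forall x y t, I x -> I y -> 0 <= t <= 1 -> I (t * x + (1 - t) * y)) ->
  concave_on I f -> concave_on I g.
Proof.
intros E C H x y t Ix Iy Ht.
rewrite <- !E; auto.
Qed.

Lemma concave_on_sub (I J : R -> Prop) (f : R -> R) :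
  (forall x, J x -> I x) -> concave_on I f -> concave_on J f.
Proof. intros S H x y t Jx Jy Ht; auto. Qed.

Lemma concave_on_plus (I : R -> Prop) (f g : R -> R) :
  concave_on I f -> concave_on I g -> concave_on I (fun x => f x + g x).
Proof.
intros Hf Hg x y t Ix Iy Ht.
specialize (Hf x y t Ix Iy Ht); specialize (Hg x y t Ix Iy Ht); lra.
Qed.

Lemma concave_on_limit (I : R -> Prop) (u : nat -> R -> R) (f : R -> R) :
  (forall x y t, I x -> I y -> 0 <= t <= 1 -> I (t * x + (1 - t) * y)) ->
  (forall n, concave_on I (u n)) ->
  (forall x, I x -> is_lim_seq (fun n => u n x) (f x)) ->
  concave_on I f.
Proof.
intros C Hu Hl x y t Ix Iy Ht.
apply (is_lim_seq_le (fun n => t * u n x + (1 - t) * u n y)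
         (fun n => u n (t * x + (1 - t) * y))
         (t * f x + (1 - t) * f y) (f (t * x + (1 - t) * y))).
- intro n; apply Hu; assumption.
- apply is_lim_seq_plus'.
  + apply (is_lim_seq_scal_l _ t (f x)); auto.
  + apply (is_lim_seq_scal_l _ (1 - t) (f y)); auto.
- auto.
Qed.

Lemma ray_convex (a x y t : R) :
  a < x -> a < y -> 0 <= t <= 1 -> a < t * x + (1 - t) * y.
Proof.
intros Hx Hy Ht.
assert (0 <= t * (x - a)) by (apply Rmult_le_pos; lra).
assert (0 <= (1 - t) * (y - a)) by (apply Rmult_le_pos; lra).
destruct (Rle_lt_dec t (1/2)); nra.
Qed.

Lemma mean_value (a : R) (f f1 : R -> R) (x y : R) :
  (forall z, a < z -> is_derive f z (f1 z)) -> a < x -> a < y ->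
  exists c, Rmin x y <= c <= Rmax x y /\ f y - f x = f1 c * (y - x).
Proof.
intros D Hx Hy.
assert (a < Rmin x y) by (apply Rmin_glb_lt; assumption).
apply MVT_gen.
- intros z Hz; apply D; lra.
- intros z Hz. apply continuity_pt_filterlim.
  apply (ex_derive_continuous f z). exists (f1 z); apply D; lra.
Qed.

Lemma nonincreasing_of_derivative (a : R) (f f1 : R -> R) :
  (forall x, a < x -> is_derive f x (f1 x)) ->
  (forall x, a < x -> f1 x <= 0) ->
  forall x y, a < x -> x <= y -> f y <= f x.
Proof.
intros D N x y Hx Hxy.
destruct (mean_value a f f1 x y D Hx) as [c [Hc E]]; [lra|].
rewrite Rmin_left, Rmax_right in Hc by assumption.
assert (f1 c <= 0) by (apply N; lra).
nra.
Qed.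

Lemma concave_on_of_second_derivative (a : R) (f f1 f2 : R -> R) :
  (forall x, a < x -> is_derive f x (f1 x)) ->
  (forall x, a < x -> is_derive f1 x (f2 x)) ->
  (forall x, a < x -> f2 x <= 0) ->
  concave_on (fun x => a < x) f.
Proof.
intros D1 D2 N.
assert (M := nonincreasing_of_derivative a f1 f2 D2 N).
assert (T : forall z x, a < z -> a < x -> f x <= f z + f1 z * (x - z)).
{ intros z x Hz Hx.
  destruct (mean_value a f f1 z x D1 Hz Hx) as [c [Hc E]].
  destruct (Rle_lt_dec z x) as [L|L].
  - rewrite Rmin_left, Rmax_right in Hc by lra.
    assert (f1 c <= f1 z) by (apply M; lra). nra.
  - rewrite Rmin_right, Rmax_left in Hc by lra.
    assert (f1 z <= f1 c) by (apply M; lra). nra. }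
intros x y t Hx Hy Ht.
assert (Hz := ray_convex a x y t Hx Hy Ht).
set (z := t * x + (1 - t) * y) in *.
assert (Tx := T z x Hz Hx); assert (Ty := T z y Hz Hy).
assert (t * (x - z) + (1 - t) * (y - z) = 0) by (unfold z; ring).
assert (t * f x <= t * (f z + f1 z * (x - z))) by (apply Rmult_le_compat_l; lra).
assert ((1 - t) * f y <= (1 - t) * (f z + f1 z * (y - z)))
  by (apply Rmult_le_compat_l; lra).
assert (f1 z * (t * (x - z) + (1 - t) * (y - z)) = 0) by (rewrite H; ring).
lra.
Qed.

(** This is x^3 times the second derivative of h / x. *)
Definition quot_curv (x h h1 h2 : R) : R := x ^ 2 * h2 - 2 * x * h1 + 2 * h.

Lemma concave_on_quotient (a : R) (h h1 h2 : R -> R) :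
  0 <= a ->
  (forall x, a < x -> is_derive h x (h1 x)) ->
  (forall x, a < x -> is_derive h1 x (h2 x)) ->
  (forall x, a < x -> quot_curv x (h x) (h1 x) (h2 x) <= 0) ->
  concave_on (fun x => a < x) (fun x => h x / x).
Proof.
intros Ha D1 D2 N.
apply concave_on_of_second_derivative with
  (f1 := fun x => (x * h1 x - h x) / x ^ 2)
  (f2 := fun x => quot_curv x (h x) (h1 x) (h2 x) / x ^ 3).
- intros x Hx.
  assert (E1 := D1 x Hx).
  auto_derive; [repeat split; [exists (h1 x); exact E1 | lra] |].
  rewrite (is_derive_unique (fun y : R => h y) _ _ E1). field; lra.
- intros x Hx.
  assert (E1 := D1 x Hx). assert (E2 := D2 x Hx).
  auto_derive.
  { repeat split; [exists (h2 x); exact E2 | exists (h1 x); exact E1 |].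
    assert (x ^ 2 <> 0) by (apply pow_nonzero; lra). simpl in H; exact H. }
  rewrite (is_derive_unique (fun y : R => h y) _ _ E1),
    (is_derive_unique (fun y : R => h1 y) _ _ E2).
  unfold quot_curv; field; lra.
- intros x Hx. specialize (N x Hx).
  assert (0 < / x ^ 3) by (apply Rinv_0_lt_compat, pow_lt; lra).
  unfold Rdiv. nra.
Qed.

(** * The logarithmic factors of the Gauss product *)

Definition log_curv (k x : R) : R :=
  quot_curv x (- ln (1 + x / k)) (- / (x + k)) (/ (x + k) ^ 2).

Lemma log_factor_derive (k x : R) :
  0 < k -> - k < x -> is_derive (fun y => - ln (1 + y / k)) x (- / (x + k)).
Proof.
intros Hk Hx.
assert (0 < (x + k) / k) by (apply Rdiv_lt_0_compat; lra).
assert (E : (x + k) / k = 1 + x / k) by (field; lra).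
rewrite E in H.
auto_derive; [exact H|].
unfold Rdiv in *. field. lra.
Qed.

Lemma log_factor_derive2 (k x : R) :
  0 < k -> - k < x -> is_derive (fun y => - / (y + k)) x (/ (x + k) ^ 2).
Proof.
intros Hk Hx. auto_derive; [lra|]. field; lra.
Qed.

(** The derivative of x^2 h'' - 2 x h' + 2 h is x^2 h''', and for
    h = - ln (1 + x / k) the third derivative h''' = - 2 / (x + k)^3 is negative.  Hence [log_curv k] is negative on
    x > 0, where it starts from 0, and on a ray it is controlled by its value
    at the left endpoint. *)
Lemma log_curv_nonincreasing (k x y : R) :
  0 < k -> - k < x -> x <= y -> log_curv k y <= log_curv k x.
Proof.
intros Hk. revert x y.
apply nonincreasing_of_derivative with (f1 := fun x => - (2 * x ^ 2 / (x + k) ^ 3)).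
- intros x Hx. unfold log_curv, quot_curv.
  assert (0 < (x + k) / k) by (apply Rdiv_lt_0_compat; lra).
  assert (E : (x + k) / k = 1 + x / k) by (field; lra).
  rewrite E in H.
  auto_derive.
  + repeat split; try lra; try exact H.
    assert (0 < (x + k) ^ 2) by (apply pow_lt; lra). simpl in H0; lra.
  + unfold Rdiv in *. field. repeat split; lra.
- intros x Hx.
  assert (0 < / (x + k) ^ 3) by (apply Rinv_0_lt_compat, pow_lt; lra).
  assert (0 <= x ^ 2) by apply pow2_ge_0.
  unfold Rdiv. nra.
Qed.

Lemma log_curv_0 (k : R) : 0 < k -> log_curv k 0 = 0.
Proof.
intro Hk. unfold log_curv, quot_curv.
replace (1 + 0 / k) with 1 by (field; lra). rewrite ln_1. ring.
Qed.

Lemma concave_on_log_factor (k : R) :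
  0 < k -> concave_on (fun x => 0 < x) (fun x => - ln (1 + x / k) / x).
Proof.
intro Hk.
apply concave_on_quotient with
  (h := fun x => - ln (1 + x / k)) (h1 := fun x => - / (x + k))
  (h2 := fun x => / (x + k) ^ 2).
- lra.
- intros x Hx; apply log_factor_derive; lra.
- intros x Hx; apply log_factor_derive2; lra.
- intros x Hx. fold (log_curv k x). rewrite <- (log_curv_0 k Hk).
  apply log_curv_nonincreasing; lra.
Qed.

(** * Elementary bounds on exp and ln *)

Lemma exp_le_compat (p q : R) : p <= q -> exp p <= exp q.
Proof.
intros [H| ->]; [left; apply exp_increasing; exact H | right; reflexivity].
Qed.

Lemma ln_le_minus_1 (z : R) : 0 < z -> ln z <= z - 1.
Proof.
intro Hz. rewrite <- (ln_exp (z - 1)).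
apply Rcomplements.ln_le; [assumption|].
assert (H := exp_ineq1_le (z - 1)). lra.
Qed.

Lemma ln_ge_1_minus_inv (z : R) : 0 < z -> 1 - / z <= ln z.
Proof.
intro Hz. assert (H := ln_le_minus_1 (/ z) (Rinv_0_lt_compat _ Hz)).
rewrite ln_Rinv in H by assumption. lra.
Qed.

Lemma exp_INR_mult (n : nat) (y : R) : exp (INR n * y) = exp y ^ n.
Proof.
induction n as [|n IH]; [simpl; rewrite Rmult_0_l; apply exp_0|].
rewrite S_INR, Rmult_plus_distr_r, Rmult_1_l, exp_plus, IH. simpl; ring.
Qed.

(** Each side compares 2 with a power of a small exponential, on which the
    tangent line of exp at 0 is nearly exact: exp 0.02 <= 1 / (1 - 0.02) for
    the lower bound and exp 0.0355 >= 1 + 0.0355 for the upper one. *)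
Lemma ln_2_bounds : 0.68 <= ln 2 <= 0.71.
Proof.
split.
- rewrite <- (ln_exp 0.68). apply Rcomplements.ln_le; [apply exp_pos|].
  replace 0.68 with (INR 34 * 0.02) by (simpl; lra).
  rewrite exp_INR_mult.
  apply Rle_trans with (1.0205 ^ 34); [|simpl; lra].
  apply pow_incr. split; [left; apply exp_pos|].
  assert (E := exp_ineq1_le (Ropp 0.02)). rewrite exp_Ropp in E.
  assert (P := exp_pos 0.02).
  assert (exp 0.02 * / exp 0.02 = 1) by (apply Rinv_r; lra). nra.
- rewrite <- (ln_exp 0.71). apply Rcomplements.ln_le; [lra|].
  replace (0.71) with (INR 20 * 0.0355) by (simpl; lra).
  rewrite exp_INR_mult.
  apply Rle_trans with ((1 + 0.0355) ^ 20); [simpl; lra|].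
  apply pow_incr. split; [lra|]. apply exp_ineq1_le.
Qed.

(** * Partial sums of the zeta function *)

(** The power n^(-x) is written exp (- (x ln n)), which displays the
    derivatives in x term by term. *)
Definition zeta_sum (N : nat) (x : R) : R :=
  sum_n (fun n => exp (- (x * ln (INR (S n))))) N.

Definition zeta_sum1 (N : nat) (x : R) : R :=
  sum_n (fun n => - ln (INR (S n)) * exp (- (x * ln (INR (S n))))) N.

Definition zeta_sum2 (N : nat) (x : R) : R :=
  sum_n (fun n => ln (INR (S n)) ^ 2 * exp (- (x * ln (INR (S n))))) N.

Lemma zeta_sum_derive (N : nat) (x : R) :
  is_derive (zeta_sum N) x (zeta_sum1 N x).
Proof.
unfold zeta_sum, zeta_sum1.
apply (is_derive_sum_n (fun n y => exp (- (y * ln (INR (S n)))))).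
intros n _. generalize (ln (INR (S n))); intro l.
auto_derive; [exact I | ring].
Qed.

Lemma zeta_sum_derive2 (N : nat) (x : R) :
  is_derive (zeta_sum1 N) x (zeta_sum2 N x).
Proof.
unfold zeta_sum1, zeta_sum2.
apply (is_derive_sum_n (fun n y => - ln (INR (S n)) * exp (- (y * ln (INR (S n)))))).
intros n _. generalize (ln (INR (S n))); intro l.
auto_derive; [exact I | ring].
Qed.

Lemma sum_n_S (u : nat -> R) (N : nat) :
  sum_n u (S N) = sum_n u N + u (S N).
Proof. exact (sum_Sn u N). Qed.

Lemma sum_n_le (u v : nat -> R) (N : nat) :
  (forall n, u n <= v n) -> sum_n u N <= sum_n v N.
Proof.
intro H. induction N as [|N IH].
- rewrite !sum_O; apply H.
- rewrite !sum_n_S. apply Rplus_le_compat; auto.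
Qed.

Lemma sum_n_nonneg (u : nat -> R) (N : nat) :
  (forall n, 0 <= u n) -> 0 <= sum_n u N.
Proof.
intro H. induction N as [|N IH].
- rewrite sum_O; apply H.
- rewrite sum_n_S. apply Rplus_le_le_0_compat; auto.
Qed.

Lemma ln_INR_S_nonneg (n : nat) : 0 <= ln (INR (S n)).
Proof.
rewrite <- ln_1. apply Rcomplements.ln_le; [lra|].
rewrite S_INR. assert (H := pos_INR n). lra.
Qed.

Lemma sum_n_ge_first (u : nat -> R) (N : nat) :
  (forall n, 0 <= u n) -> u O <= sum_n u N.
Proof.
intro H. induction N as [|N IH].
- rewrite sum_O; lra.
- rewrite sum_n_S. specialize (H (S N)). lra.
Qed.

Lemma zeta_sum_ge_1 (N : nat) (x : R) : 1 <= zeta_sum N x.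
Proof.
unfold zeta_sum.
replace 1 with (exp (- (x * ln (INR 1)))) at 1
  by (simpl; rewrite ln_1, Rmult_0_r, Ropp_0; apply exp_0).
apply (sum_n_ge_first (fun n => exp (- (x * ln (INR (S n)))))).
intro n; left; apply exp_pos.
Qed.

(** * The contribution of the zeta function *)

Definition ln_zeta_curv (N : nat) (x : R) : R :=
  quot_curv x (ln (zeta_sum N x)) (zeta_sum1 N x / zeta_sum N x)
   ((zeta_sum2 N x * zeta_sum N x - zeta_sum1 N x ^ 2) / zeta_sum N x ^ 2).

(** What [quot_curv] gives on the single term n^(-x), as a function of
    y = x ln n. *)
Definition dirichlet_bound (y : R) : R := (y ^ 2 + 2 * y + 2) * exp (- y).

(** Let Z be the partial sum.  Since Z >= 1, Z' <= 0 and Z'' >= 0, the three parts of [ln_zeta_curv] are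
    bounded by replacing ln Z by Z - 1, Z'/Z by Z' and (ln Z)'' by Z''; what
    results is linear in Z.  The term n = 1 of Z contributes the 2 on the
    left-hand side. *)
Lemma ln_zeta_curv_le_sum (N : nat) (x : R) :
  0 < x ->
  ln_zeta_curv N x + 2 <= sum_n (fun n => dirichlet_bound (x * ln (INR (S n)))) N.
Proof.
intro Hx.
assert (Z := zeta_sum_ge_1 N x).
assert (Z1 : zeta_sum1 N x <= 0).
{ unfold zeta_sum1. apply Rle_trans with (sum_n (fun _ => 0) N).
  - apply sum_n_le; intro n. assert (L := ln_INR_S_nonneg n).
    assert (P := exp_pos (- (x * ln (INR (S n))))). nra.
  - rewrite sum_n_const; lra. }
assert (Z2 : 0 <= zeta_sum2 N x).
{ apply sum_n_nonneg; intro n.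
  apply Rmult_le_pos; [apply pow2_ge_0 | left; apply exp_pos]. }
assert (E : x ^ 2 * zeta_sum2 N x - 2 * x * zeta_sum1 N x + 2 * zeta_sum N x =
  sum_n (fun n => dirichlet_bound (x * ln (INR (S n)))) N).
{ clear. unfold zeta_sum, zeta_sum1, zeta_sum2.
  induction N as [|N IH]; [rewrite !sum_O | rewrite !sum_n_S, <- IH];
  unfold dirichlet_bound; ring. }
rewrite <- E. unfold ln_zeta_curv, quot_curv.
set (z := zeta_sum N x) in *. set (z1 := zeta_sum1 N x) in *.
set (z2 := zeta_sum2 N x) in *.
assert (Lz := ln_le_minus_1 z ltac:(lra)).
assert (I1 : 0 < / z <= 1).
{ split; [apply Rinv_0_lt_compat; lra | rewrite <- Rinv_1; apply Rinv_le_contravar; lra]. }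
assert (A1 : z1 <= z1 / z) by (unfold Rdiv; nra).
assert (A2 : (z2 * z - z1 ^ 2) / z ^ 2 <= z2).
{ replace ((z2 * z - z1 ^ 2) / z ^ 2) with (z2 * / z - (z1 * / z) ^ 2) by (field; lra).
  assert (S := pow2_ge_0 (z1 * / z)). nra. }
assert (0 <= x ^ 2) by apply pow2_ge_0.
assert (x ^ 2 * ((z2 * z - z1 ^ 2) / z ^ 2) <= x ^ 2 * z2)
  by (apply Rmult_le_compat_l; assumption).
assert (x * z1 <= x * (z1 / z)) by (apply Rmult_le_compat_l; lra).
lra.
Qed.

(** At the endpoint y = 6 ln 2 the exponential is exactly 8, and the quadratic is
    below 28.8 = 3.6 * 8; beyond it, with y = 6 ln 2 + d, the crude bound
    exp (d / 2) >= (1 + d / 4)^2 already grows faster than the quadratic. *)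
Lemma quadratic_le_exp_half (y : R) :
  6 * ln 2 <= y -> y ^ 2 + 2 * y + 2 <= 3.6 * exp (y / 2).
Proof.
intro Hy. assert (L2 := ln_2_bounds).
set (y0 := 6 * ln 2) in *.
assert (B : 0 <= y0 <= 4.26) by (unfold y0; lra).
set (d := y - y0). assert (Hd : 0 <= d) by (unfold d; lra).
assert (E : exp (y / 2) = 8 * exp (d / 4) ^ 2).
{ replace (y / 2) with (INR 3 * ln 2 + INR 2 * (d / 4))
    by (unfold d, y0; simpl; field).
  rewrite exp_plus, !exp_INR_mult, exp_ln by lra. simpl; ring. }
rewrite E.
assert (P : (1 + d / 4) ^ 2 <= exp (d / 4) ^ 2).
{ apply pow_incr. split; [lra | apply exp_ineq1_le]. }
replace y with (y0 + d) by (unfold d; ring).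
apply Rle_trans with (3.6 * (8 * (1 + d / 4) ^ 2)); [nra | lra].
Qed.

(** Telescoping: 1/n^3 < 1/((n-1) n (n+1)), and the latter sum to 1/4 over
    n >= 2; the term n = 1 accounts for the rest of 5/4. *)
Lemma sum_cubes_le (N : nat) :
  sum_n (fun n => / INR (S n) ^ 3) N <= 5 / 4 - / (2 * (INR N + 1) * (INR N + 2)).
Proof.
induction N as [|N IH].
- rewrite sum_O; simpl; lra.
- rewrite sum_n_S. apply Rle_trans with (1 := Rplus_le_compat_r _ _ _ IH).
  rewrite !S_INR. assert (P := pos_INR N). set (m := INR N) in *.
  cut (0 <= / (2 * (m + 1) * (m + 2)) - / (2 * (m + 1 + 1) * (m + 1 + 2)) - / (m + 1 + 1) ^ 3);
    [lra|].
  replace (_ - _ - _) with (/ ((m + 1) * (m + 2) ^ 3 * (m + 3))) by (field; lra).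
  left; apply Rinv_0_lt_compat.
  repeat apply Rmult_lt_0_compat; try apply pow_lt; lra.
Qed.

Lemma zeta_term_le_cube (n : nat) (x : R) :
  3 <= x -> exp (- (x * ln (INR (S n)))) <= / INR (S n) ^ 3.
Proof.
intro Hx. assert (L := ln_INR_S_nonneg n).
assert (0 < INR (S n)) by (apply lt_0_INR; lia).
rewrite exp_Ropp. apply Rinv_le_contravar; [apply pow_lt; assumption|].
rewrite <- (exp_ln (INR (S n))) at 1 by assumption.
rewrite <- exp_INR_mult. apply Rnot_lt_le; intro K. apply exp_lt_inv in K. simpl in K; simpl in L; nra.
Qed.

(** For n >= 2 and x >= 6, y = x ln n is at least 6 ln 2, so
    q(y) <= 3.6 exp (- y / 2) <= 3.6 / n^3, and the sum is at most 3.6 / 4. *)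
Lemma ln_zeta_curv_le (N : nat) (x : R) : 6 <= x -> ln_zeta_curv N x <= 0.9.
Proof.
intro Hx.
assert (B : sum_n (fun n => dirichlet_bound (x * ln (INR (S n)))) N <=
            2 + 3.6 * (sum_n (fun n => / INR (S n) ^ 3) N - 1)).
{ induction N as [|N IH].
  - rewrite !sum_O. unfold dirichlet_bound. simpl INR.
    rewrite ln_1, Rmult_0_r, Ropp_0, exp_0. lra.
  - rewrite !sum_n_S.
    assert (T : dirichlet_bound (x * ln (INR (S (S N)))) <= 3.6 * / INR (S (S N)) ^ 3).
    { set (l := ln (INR (S (S N)))).
      assert (Hl : ln 2 <= l).
      { apply Rcomplements.ln_le; [lra|]. rewrite !S_INR.
        assert (P := pos_INR N). lra. }
      assert (L2 := ln_2_bounds).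
      assert (Q := quadratic_le_exp_half (x * l) ltac:(nra)).
      apply Rle_trans with (3.6 * exp (- (x / 2 * l))).
      - unfold dirichlet_bound.
        replace (- (x / 2 * l)) with (x * l / 2 + - (x * l)) by field.
        rewrite exp_plus.
        assert (P := exp_pos (- (x * l))). nra.
      - apply Rmult_le_compat_l; [lra|].
        apply zeta_term_le_cube; lra. }
    lra. }
assert (S := ln_zeta_curv_le_sum N x ltac:(lra)).
assert (C := sum_cubes_le N).
assert (P := pos_INR N).
assert (0 < / (2 * (INR N + 1) * (INR N + 2)))
  by (apply Rinv_0_lt_compat; repeat apply Rmult_lt_0_compat; lra).
lra.
Qed.

(** The part of the approximant that is not visibly concave, together with just
    enough factors of the Gauss product to compensate it: two factors would
    leave too little room for the bound 0.9. *)
Definition zeta_log_head (N : nat) (x : R) : R :=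
  ln 2 + ln (zeta_sum N x) - (ln (1 + x / 1) + ln (1 + x / 2) + ln (1 + x / 3)).

Lemma concave_on_zeta_log_head (N : nat) :
  concave_on (fun x => 6 < x) (fun x => zeta_log_head N x / x).
Proof.
apply concave_on_quotient with
  (h1 := fun x => zeta_sum1 N x / zeta_sum N x
                  + (- / (x + 1) + - / (x + 2) + - / (x + 3)))
  (h2 := fun x =>
     (zeta_sum2 N x * zeta_sum N x - zeta_sum1 N x ^ 2) / zeta_sum N x ^ 2
     + (/ (x + 1) ^ 2 + / (x + 2) ^ 2 + / (x + 3) ^ 2)).
- lra.
- intros x Hx. assert (Z := zeta_sum_ge_1 N x).
  assert (D := zeta_sum_derive N x).
  unfold zeta_log_head.
  apply is_derive_ext with (f := fun x => ln 2 + ln (zeta_sum N x) +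
    (- ln (1 + x / 1) + - ln (1 + x / 2) + - ln (1 + x / 3))); [intro y; simpl; lra|].
  apply (is_derive_plus (fun x => ln 2 + ln (zeta_sum N x))).
  + auto_derive; [split; [exists (zeta_sum1 N x); exact D | lra]|].
    rewrite (is_derive_unique (fun y : R => zeta_sum N y) _ _ D). field; lra.
  + repeat apply (is_derive_plus (V := R_NormedModule)); apply log_factor_derive; lra.
- intros x Hx. assert (Z := zeta_sum_ge_1 N x).
  assert (D := zeta_sum_derive N x). assert (D2 := zeta_sum_derive2 N x).
  apply (is_derive_plus (fun x => zeta_sum1 N x / zeta_sum N x)).
  + auto_derive.
    { repeat split; [exists (zeta_sum2 N x); exact D2 |
                     exists (zeta_sum1 N x); exact D | lra]. }
    rewrite (is_derive_unique (fun y : R => zeta_sum N y) _ _ D),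
      (is_derive_unique (fun y : R => zeta_sum1 N y) _ _ D2).
    field; lra.
  + repeat apply (is_derive_plus (V := R_NormedModule)); apply log_factor_derive2; lra.
- intros x Hx.
  assert (S := ln_zeta_curv_le N x ltac:(lra)).
  assert (Q1 := log_curv_nonincreasing 1 6 x ltac:(lra) ltac:(lra) ltac:(lra)).
  assert (Q2 := log_curv_nonincreasing 2 6 x ltac:(lra) ltac:(lra) ltac:(lra)).
  assert (Q3 := log_curv_nonincreasing 3 6 x ltac:(lra) ltac:(lra) ltac:(lra)).
  replace (quot_curv _ _ _ _) with
    (2 * ln 2 + ln_zeta_curv N x + log_curv 1 x + log_curv 2 x + log_curv 3 x)
    by (unfold ln_zeta_curv, log_curv, quot_curv, zeta_log_head; ring).
  (* At x = 6 the logarithms 2 ln 2 - 2 (ln 7 + ln 4 + ln 3) combine into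
     - 2 ln 42, where ln 42 exceeds 3.6. *)
  assert (V : 2 * ln 2 + log_curv 1 6 + log_curv 2 6 + log_curv 3 6
              = 6.29 - 2 * ln 42 + (12 / 7 + 36 / 49 + 33 / 16 + 16 / 9 - 6.29)).
  { unfold log_curv, quot_curv.
    replace (1 + 6 / 1) with 7 by field. replace (1 + 6 / 2) with 4 by field.
    replace (1 + 6 / 3) with 3 by field.
    replace 42 with (7 * (4 * 3) / 2) by field.
    rewrite ln_div, !ln_mult by lra. field. }
  assert (L42 : 5 * ln 2 + 10 / 42 <= ln 42).
  { replace 42 with (2 ^ 5 * (42 / 32)) at 2 by lra.
    rewrite ln_mult, ln_pow by lra.
    assert (T := ln_ge_1_minus_inv (42 / 32) ltac:(lra)).
    simpl INR. replace (/ (42 / 32)) with (32 / 42) in T by field. lra. }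
  assert (L2 := ln_2_bounds). lra.
Qed.

(** * Improper integrals over the positive half-line *)

Notation is_improper f l := (is_RInt_gen f (at_right 0) (Rbar_locally p_infty) l).

Lemma near_endpoints (P : R * R -> Prop) (a0 b0 : R) :
  0 < a0 -> (forall a b, 0 < a < a0 -> b0 < b -> P (a, b)) ->
  filter_prod (at_right 0) (Rbar_locally p_infty) P.
Proof.
intros Ha HP.
apply Filter_prod with (Q := fun a => 0 < a < a0) (R := fun b => b0 < b).
- exists (mkposreal a0 Ha). intros y B H.
  apply Rabs_lt_between' in B. simpl in B. lra.
- exists b0; auto.
- exact HP.
Qed.

Lemma near_positive (P : R -> Prop) :
  (forall x, 0 < x -> P x) ->
  filter_prod (at_right 0) (Rbar_locally p_infty)
    (fun ab => forall x, Rmin (fst ab) (snd ab) <= x <= Rmax (fst ab) (snd ab) -> P x).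
Proof.
intro HP. apply near_endpoints with (a0 := 1) (b0 := 1); [lra|].
intros a b Ha Hb x Hx; simpl in Hx. apply HP.
rewrite Rmin_left in Hx; lra.
Qed.

Lemma is_improper_ext (f g : R -> R) (l : R) :
  (forall x, 0 < x -> f x = g x) -> is_improper f l -> is_improper g l.
Proof.
intro E. apply is_RInt_gen_ext.
apply filter_imp with (2 := near_positive _ E).
intros ab H x Hx. apply H; lra.
Qed.

Lemma improper_le (f g : R -> R) (lf lg : R) :
  (forall x, 0 < x -> 0 <= f x <= g x) ->
  is_improper f lf -> is_improper g lg -> lf <= lg.
Proof.
intros H If Ig. apply Rle_trans with (1 := Rle_abs lf).
apply (RInt_gen_norm (V := R_CompleteNormedModule)
  (Fa := at_right 0) (Fb := Rbar_locally p_infty) f g lf lg); trivial.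
- apply near_endpoints with (a0 := 1) (b0 := 1); simpl; intros; lra.
- apply near_endpoints with (a0 := 1) (b0 := 1); [lra|].
  simpl; intros a b Ha Hb x Hx. specialize (H x ltac:(lra)).
  change (Rabs (f x) <= g x). rewrite Rabs_pos_eq; lra.
Qed.

(** By positivity the integrals over compact intervals increase with the
    interval, so the improper integral is their supremum; the second conclusion
    keeps the fact that it is an upper bound, which later gives positivity of
    Gamma. *)
Lemma improper_exists (f : R -> R) (M : R) :
  (forall t, 0 < t -> continuous f t) ->
  (forall t, 0 < t -> 0 <= f t) ->
  (forall a b, 0 < a <= b -> RInt f a b <= M) ->
  exists l, is_improper f l /\ forall a b, 0 < a <= b -> RInt f a b <= l.
Proof.
intros C P B.
destruct (completeness (fun m => exists a b, 0 < a <= b /\ m = RInt f a b))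
  as [l [Hu Hl]].
{ exists M. intros m [a [b [H ->]]]. apply B; exact H. }
{ exists (RInt f 1 1), 1, 1. split; [lra | reflexivity]. }
exists l. split; [| intros a b H; apply Hu; exists a, b; auto].
assert (I : forall a b, 0 < a <= b -> ex_RInt f a b).
{ intros a b H. apply (ex_RInt_continuous (V := R_CompleteNormedModule)).
  intros z Hz. rewrite Rmin_left in Hz by lra. apply C; lra. }
assert (N : forall a b, 0 < a <= b -> 0 <= RInt f a b).
{ intros a b H. apply RInt_ge_0; [lra | apply I; exact H | intros; apply P; lra]. }
apply filterlimi_locally. intro eps.
assert (Heps := cond_pos eps).
destruct (Classical_Prop.classic
  (exists a b, 0 < a <= b /\ l - eps < RInt f a b)) as [[a0 [b0 [H0 K]]] | NE].
- apply near_endpoints with (a0 := a0) (b0 := b0); [lra|].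
  intros a b Ha Hb. exists (RInt f a b). simpl.
  split; [apply (RInt_correct (V := R_CompleteNormedModule)), I; lra|].
  assert (E1 : RInt f a a0 + RInt f a0 b = RInt f a b)
    by (apply (RInt_Chasles (V := R_CompleteNormedModule)); apply I; lra).
  assert (E2 : RInt f a0 b0 + RInt f b0 b = RInt f a0 b)
    by (apply (RInt_Chasles (V := R_CompleteNormedModule)); apply I; lra).
  assert (N1 := N a a0 ltac:(lra)). assert (N2 := N b0 b ltac:(lra)).
  assert (U : RInt f a b <= l) by (apply Hu; exists a, b; split; [lra | reflexivity]).
  apply Rabs_lt_between'. lra.
- exfalso. assert (l <= l - eps); [|lra].
  apply Hl. intros m [a [b [H ->]]].
  apply Rnot_lt_le. intro K. apply NE. exists a, b; auto.
Qed.

(** * The Gamma function *)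

(** The integrand of Gamma(s + 1): the shift makes s >= 0 the natural range. *)
Definition gamma_integrand (s t : R) : R := Rpower t s * exp (- t).

Lemma gamma_integrand_continuous (s t : R) :
  0 < t -> continuous (gamma_integrand s) t.
Proof.
intro Ht. apply (ex_derive_continuous (gamma_integrand s)).
unfold gamma_integrand, Rpower. auto_derive. lra.
Qed.

Lemma gamma_integrand_pos (s t : R) : 0 < gamma_integrand s t.
Proof. apply Rmult_lt_0_compat; apply exp_pos. Qed.

(** Half of the decay exp (- t) absorbs the power: the tangent line of ln at
    c = 2 (s + 1) gives s ln t <= s ln c + s t / c <= s ln c + t / 2. *)
Lemma gamma_integrand_le (s t : R) :
  0 <= s -> 0 < t ->
  gamma_integrand s t <= Rpower (2 * (s + 1)) s * exp (- (t / 2)).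
Proof.
intros Hs Ht. unfold gamma_integrand, Rpower. rewrite <- !exp_plus.
apply exp_le_compat.
assert (0 < t / (2 * (s + 1))) by (apply Rdiv_lt_0_compat; lra).
assert (L := ln_le_minus_1 _ H).
rewrite ln_div in L by lra.
assert (s * (ln t - ln (2 * (s + 1))) <= s * (t / (2 * (s + 1)) - 1))
  by (apply Rmult_le_compat_l; lra).
replace (s * (t / (2 * (s + 1)) - 1)) with (t / 2 - t / (2 * (s + 1)) - s) in H0
  by (field; lra).
lra.
Qed.

Lemma gamma_integral_exists (s : R) :
  0 <= s -> exists l, 0 < l /\ is_improper (gamma_integrand s) l.
Proof.
intro Hs. set (C := Rpower (2 * (s + 1)) s).
assert (HC : 0 < C) by apply exp_pos.
destruct (improper_exists (gamma_integrand s) (2 * C)) as [l [Hl U]].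
- apply gamma_integrand_continuous.
- intros t _; left; apply gamma_integrand_pos.
- intros a b Hab.
  assert (I : is_RInt (fun t => C * exp (- (t / 2))) a b
               (2 * C * (exp (- (a / 2)) - exp (- (b / 2))))).
  { evar_last.
    { apply (is_RInt_derive (fun t => - (2 * C * exp (- (t / 2))))).
      - intros x _. auto_derive; [exact I | unfold Rdiv; field].
      - intros x _. apply (ex_derive_continuous (fun t => C * exp (- (t / 2)))).
        auto_derive; exact I. }
    unfold minus, plus, opp; simpl; ring. }
  apply Rle_trans with (RInt (fun t => C * exp (- (t / 2))) a b).
  + apply RInt_le; [lra | | eexists; exact I |].
    * apply (ex_RInt_continuous (V := R_CompleteNormedModule)).
      intros z Hz. rewrite Rmin_left in Hz by lra.
      apply gamma_integrand_continuous; lra.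
    * intros x Hx. apply gamma_integrand_le; lra.
  + rewrite (is_RInt_unique _ _ _ _ I).
    assert (P := exp_pos (- (b / 2))).
    assert (exp (- (a / 2)) <= 1) by (rewrite <- exp_0; apply exp_le_compat; lra).
    nra.
- exists l. split; [|exact Hl].
  apply Rlt_le_trans with (2 := U 1 2 ltac:(lra)).
  apply RInt_gt_0; [lra | intros; apply gamma_integrand_pos |].
  intros; apply gamma_integrand_continuous; lra.
Qed.

Lemma Gamma_unique (s l : R) : is_improper (gamma_integrand s) l -> Gamma (s + 1) = l.
Proof.
intro H. unfold Gamma. apply is_RInt_gen_unique.
apply is_improper_ext with (2 := H).
intros x _. unfold gamma_integrand. do 2 f_equal; ring.
Qed.

Lemma Gamma_correct (s : R) :
  0 <= s -> 0 < Gamma (s + 1) /\ is_improper (gamma_integrand s) (Gamma (s + 1)).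
Proof.
intro Hs. destruct (gamma_integral_exists s Hs) as [l [P I]].
rewrite (Gamma_unique s l I). auto.
Qed.

Lemma improper_of_derivative (F f : R -> R) (la lb : R) :
  (forall t, 0 < t -> is_derive F t (f t)) ->
  (forall t, 0 < t -> continuous f t) ->
  filterlim F (at_right 0) (locally la) ->
  filterlim F (Rbar_locally p_infty) (locally lb) ->
  is_improper f (lb - la).
Proof.
intros D C La Lb.
apply is_improper_ext with (f := Derive F).
{ intros x Hx; apply is_derive_unique, D; exact Hx. }
apply is_RInt_gen_Derive; trivial.
- apply near_positive. intros x Hx; eexists; apply D; exact Hx.
- apply near_positive. intros x Hx.
  apply continuous_ext_loc with (g := f); [|apply C; exact Hx].
  exists (mkposreal x Hx). intros y B. apply Rabs_lt_between' in B. simpl in B.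
  symmetry; apply is_derive_unique, D; lra.
Qed.

Lemma exp_tail_limit (F : R -> R) (C : R) :
  (forall t, 0 < t -> Rabs (F t) <= C * exp (- (t / 2))) ->
  filterlim F (Rbar_locally p_infty) (locally 0).
Proof.
intros B. apply filterlim_locally. intro eps. assert (He := cond_pos eps).
exists (Rmax 0 (2 * C / eps)). intros t Ht.
assert (t > 0) by (assert (K := Rmax_l 0 (2 * C / eps)); lra).
assert (T : 2 * C / eps < t) by (assert (K := Rmax_r 0 (2 * C / eps)); lra).
change (Rabs (F t - 0) < eps). rewrite Rminus_0_r.
apply Rle_lt_trans with (1 := B t H).
assert (E := exp_ineq1_le (t / 2)).
assert (Q : exp (- (t / 2)) * exp (t / 2) = 1) by (rewrite <- exp_plus, <- exp_0; f_equal; ring).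
assert (P := exp_pos (- (t / 2))).
apply Rmult_lt_reg_r with (exp (t / 2)); [apply exp_pos|].
rewrite Rmult_assoc, Q.
assert (2 * C < t * eps).
{ replace (2 * C) with (2 * C / eps * eps) by (field; lra).
  apply Rmult_lt_compat_r; assumption. }
nra.
Qed.

Lemma Gamma_1 : Gamma (0 + 1) = 1.
Proof.
apply Gamma_unique.
apply is_improper_ext with (f := fun t => exp (- t)).
{ intros x Hx. unfold gamma_integrand. rewrite Rpower_O by exact Hx. ring. }
replace 1 with (0 - -1) by ring.
apply improper_of_derivative with (F := fun t => - exp (- t)).
- intros t _. auto_derive; [exact I | ring].
- intros t _. apply (ex_derive_continuous (fun t => exp (- t))). auto_derive; exact I.
- refine (filterlim_filter_le_1 (F := locally 0) _ (filter_le_within _) _).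
  replace (-1) with (- exp (- 0)) by (rewrite Ropp_0, exp_0; ring).
  apply (ex_derive_continuous (fun t => - exp (- t)) 0). auto_derive; exact I.
- apply exp_tail_limit with (C := 1). intros t Ht.
  rewrite Rabs_Ropp, Rabs_pos_eq by (left; apply exp_pos).
  rewrite Rmult_1_l. apply exp_le_compat; lra.
Qed.

(** Integration by parts, read as: the derivative of t^(s+1) exp (- t), which
    vanishes at both ends, has integral 0. *)
Lemma Gamma_S (s : R) : 0 <= s -> Gamma (s + 1 + 1) = (s + 1) * Gamma (s + 1).
Proof.
intro Hs.
destruct (Gamma_correct s Hs) as [P0 I0].
assert (I : is_improper (fun t => (s + 1) * gamma_integrand s t - gamma_integrand (s + 1) t)
              (0 - 0)).
{ apply improper_of_derivative with (F := gamma_integrand (s + 1)).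
  - intros t Ht. unfold gamma_integrand.
    rewrite Rpower_plus, Rpower_1 by exact Ht. unfold Rpower.
    auto_derive; [exact Ht|].
    replace (exp ((s + 1) * ln t)) with (exp (s * ln t) * t).
    2: { rewrite Rmult_plus_distr_r, Rmult_1_l, exp_plus, exp_ln by exact Ht.
         reflexivity. }
    field; lra.
  - intros t Ht. apply (continuous_minus (fun t => (s + 1) * gamma_integrand s t)).
    + apply (continuous_mult (fun _ => s + 1)).
      * apply continuous_const.
      * apply gamma_integrand_continuous; exact Ht.
    + apply gamma_integrand_continuous; exact Ht.
  - apply filterlim_locally. intro eps. assert (He := cond_pos eps).
    exists (mkposreal (Rmin 1 eps) (Rmin_pos _ _ Rlt_0_1 He)).
    intros t B Ht. apply Rabs_lt_between' in B. simpl in B.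
    assert (B1 := Rmin_l 1 eps). assert (B2 := Rmin_r 1 eps).
    change (Rabs (gamma_integrand (s + 1) t - 0) < eps).
    rewrite Rminus_0_r, Rabs_pos_eq by (left; apply gamma_integrand_pos).
    apply Rle_lt_trans with t; [|lra].
    unfold gamma_integrand, Rpower. rewrite <- exp_plus.
    rewrite <- (exp_ln t) at 3 by exact Ht.
    apply exp_le_compat.
    assert (ln t <= 0) by (rewrite <- ln_1; apply Rcomplements.ln_le; lra). nra.
  - apply exp_tail_limit with (C := Rpower (2 * (s + 1 + 1)) (s + 1)).
    intros t Ht. rewrite Rabs_pos_eq by (left; apply gamma_integrand_pos).
    apply gamma_integrand_le; lra. }
apply Gamma_unique.
apply is_improper_ext with
  (f := fun t => minus (scal (s + 1) (gamma_integrand s t))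
    ((s + 1) * gamma_integrand s t - gamma_integrand (s + 1) t)).
{ intros t _. unfold minus, plus, opp, scal; simpl; unfold mult; simpl; ring. }
replace ((s + 1) * Gamma (s + 1)) with (minus (scal (s + 1) (Gamma (s + 1))) (0 - 0))
  by (unfold minus, plus, opp, scal; simpl; unfold mult; simpl; ring).
apply (is_RInt_gen_minus (V := R_NormedModule)).
- apply (is_RInt_gen_scal (V := R_NormedModule)); exact I0.
- exact I.
Qed.

Definition lnGamma (s : R) : R := ln (Gamma (s + 1)).

Lemma exp_convex (p q t : R) :
  0 <= t <= 1 -> exp (t * p + (1 - t) * q) <= t * exp p + (1 - t) * exp q.
Proof.
intro Ht. set (m := t * p + (1 - t) * q).
assert (T : forall z, exp m * (1 + (z - m)) <= exp z).
{ intro z. replace (exp z) with (exp m * exp (z - m))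
    by (rewrite <- exp_plus; f_equal; ring).
  apply Rmult_le_compat_l; [left; apply exp_pos | apply exp_ineq1_le]. }
assert (Tp := Rmult_le_compat_l t _ _ ltac:(lra) (T p)).
assert (Tq := Rmult_le_compat_l (1 - t) _ _ ltac:(lra) (T q)).
assert (t * (exp m * (1 + (p - m))) + (1 - t) * (exp m * (1 + (q - m))) = exp m)
  by (unfold m; ring).
lra.
Qed.

(** Hoelder's inequality, by way of its usual proof: with A and B the two Gamma
    values, the weighted arithmetic-geometric inequality (convexity of exp)
    applied to the normalised integrands f_a / A and f_b / B is integrated. *)
Lemma lnGamma_convex (a b t : R) :
  0 <= a -> 0 <= b -> 0 <= t <= 1 ->
  lnGamma (t * a + (1 - t) * b) <= t * lnGamma a + (1 - t) * lnGamma b.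
Proof.
intros Ha Hb Ht.
assert (Hc : 0 <= t * a + (1 - t) * b)
  by (apply Rplus_le_le_0_compat; apply Rmult_le_pos; lra).
destruct (Gamma_correct a Ha) as [Pa Ia].
destruct (Gamma_correct b Hb) as [Pb Ib].
destruct (Gamma_correct _ Hc) as [Pc Ic].
unfold lnGamma. set (A := Gamma (a + 1)) in *. set (B := Gamma (b + 1)) in *.
set (c := t * a + (1 - t) * b) in *. set (G := Gamma (c + 1)) in *.
set (w := exp (- (t * ln A + (1 - t) * ln B))).
assert (K : scal w G <= plus (scal (t / A) A) (scal ((1 - t) / B) B)).
{ apply improper_le with
    (f := fun x => scal w (gamma_integrand c x))
    (g := fun x => plus (scal (t / A) (gamma_integrand a x))
                        (scal ((1 - t) / B) (gamma_integrand b x))).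
  - intros x Hx. unfold plus, scal; simpl; unfold mult; simpl.
    split; [left; apply Rmult_lt_0_compat; [apply exp_pos | apply gamma_integrand_pos]|].
    assert (E := exp_convex (a * ln x - x - ln A) (b * ln x - x - ln B) t Ht).
    unfold w, gamma_integrand, Rpower. rewrite <- !exp_plus.
    replace (- (t * ln A + (1 - t) * ln B) + (c * ln x + - x)) with
      (t * (a * ln x - x - ln A) + (1 - t) * (b * ln x - x - ln B))
      by (unfold c; ring).
    apply Rle_trans with (1 := E).
    unfold Rminus. rewrite (exp_plus _ (- ln A)), (exp_plus _ (- ln B)), !(exp_Ropp (ln _)), !exp_ln by assumption.
    unfold Rdiv. right; ring.
  - apply (is_RInt_gen_scal (V := R_NormedModule)); exact Ic.
  - apply (is_RInt_gen_plus (V := R_NormedModule));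
      apply (is_RInt_gen_scal (V := R_NormedModule)); assumption. }
unfold plus, scal in K; simpl in K; unfold mult in K; simpl in K.
replace (t / A * A + (1 - t) / B * B) with 1 in K by (field; lra).
apply Rcomplements.ln_le in K; [|apply Rmult_lt_0_compat; [apply exp_pos | exact Pc]].
rewrite ln_1, ln_mult in K by (trivial; apply exp_pos).
unfold w in K. rewrite ln_exp in K. lra.
Qed.

Lemma lnGamma_0 : lnGamma 0 = 0.
Proof. unfold lnGamma. rewrite Gamma_1. apply ln_1. Qed.

Lemma lnGamma_S (s : R) : 0 <= s -> lnGamma (s + 1) = ln (s + 1) + lnGamma s.
Proof.
intro Hs. unfold lnGamma. rewrite Gamma_S by exact Hs.
apply ln_mult; [lra | apply Gamma_correct; exact Hs].
Qed.

(** By convexity the slope of L on [y, y + x] lies between the slopes on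
    [y - 1, y] and on [y + x, y + x + 1], which the functional equation makes
    logarithms. *)
Lemma lnGamma_increment (y x : R) :
  1 <= y -> 0 < x ->
  x * ln y <= lnGamma (y + x) - lnGamma y <= x * ln (y + x + 1).
Proof.
intros Hy Hx.
assert (0 < x / (1 + x) < 1).
{ split; [apply Rdiv_lt_0_compat; lra|].
  apply Rmult_lt_reg_r with (1 + x); [lra|].
  unfold Rdiv; rewrite Rmult_assoc, Rinv_l; lra. }
split.
- assert (C := lnGamma_convex (y - 1) (y + x) (x / (1 + x)) ltac:(lra) ltac:(lra) ltac:(lra)).
  replace (x / (1 + x) * (y - 1) + (1 - x / (1 + x)) * (y + x)) with y in C by (field; lra).
  assert (S := lnGamma_S (y - 1) ltac:(lra)).
  replace (y - 1 + 1) with y in S by ring.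
  apply (Rmult_le_compat_l (1 + x)) in C; [|lra].
  replace ((1 + x) * (x / (1 + x) * lnGamma (y - 1) + (1 - x / (1 + x)) * lnGamma (y + x)))
    with (x * lnGamma (y - 1) + lnGamma (y + x)) in C by (field; lra).
  nra.
- assert (C := lnGamma_convex (y + x + 1) y (x / (1 + x)) ltac:(lra) ltac:(lra) ltac:(lra)).
  replace (x / (1 + x) * (y + x + 1) + (1 - x / (1 + x)) * y) with (y + x) in C by (field; lra).
  assert (S := lnGamma_S (y + x) ltac:(lra)).
  apply (Rmult_le_compat_l (1 + x)) in C; [|lra].
  replace ((1 + x) * (x / (1 + x) * lnGamma (y + x + 1) + (1 - x / (1 + x)) * lnGamma y))
    with (x * lnGamma (y + x + 1) + lnGamma y) in C by (field; lra).
  nra.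
Qed.

(** * The Gauss product *)

Definition log_product (n : nat) (x : R) : R :=
  sum_n (fun k => ln (1 + x / INR (S k))) n.

(** Telescoping of the functional equation; the base value L(0) = 0 fixes the
    constant. *)
Lemma lnGamma_shift (n : nat) (x : R) :
  0 <= x ->
  lnGamma (INR (S n) + x) - lnGamma (INR (S n)) = lnGamma x + log_product n x.
Proof.
intro Hx.
assert (step : forall m, lnGamma (INR (S m) + x) - lnGamma (INR (S m)) =
  lnGamma (INR m + x) - lnGamma (INR m) + ln (1 + x / INR (S m))).
{ intro m. rewrite S_INR. assert (P := pos_INR m).
  replace (INR m + 1 + x) with (INR m + x + 1) by ring.
  rewrite !lnGamma_S by lra.
  replace (1 + x / (INR m + 1)) with ((INR m + x + 1) / (INR m + 1)) by (field; lra).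
  rewrite ln_div by lra. ring. }
rewrite step. unfold log_product. induction n as [|n IH].
- rewrite sum_O. change (INR 0) with 0. rewrite Rplus_0_l, lnGamma_0. ring.
- rewrite sum_n_S, step, IH. ring.
Qed.

(** The two bounds of [lnGamma_increment] at y = n + 1 differ by
    x ln (1 + (x + 1) / y), hence by at most x (x + 1) / y. *)
Lemma lnGamma_limit (x : R) :
  0 < x ->
  is_lim_seq (fun n => ln (INR (S n)) - log_product n x / x) (lnGamma x / x).
Proof.
intro Hx.
apply is_lim_seq_le_le with
  (u := fun n => lnGamma x / x - (x + 1) * / INR (S n)) (w := fun n => lnGamma x / x).
- intro n. assert (P := pos_INR n).
  assert (Y : 1 <= INR (S n)) by (rewrite S_INR; lra).
  destruct (lnGamma_increment (INR (S n)) x Y Hx) as [Lo Up].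
  rewrite lnGamma_shift in Lo, Up by lra.
  set (y := INR (S n)) in *. set (p := log_product n x) in *.
  assert (D : ln (y + x + 1) - ln y <= (x + 1) * / y).
  { rewrite <- ln_div by lra.
    apply Rle_trans with ((y + x + 1) / y - 1).
    - apply ln_le_minus_1, Rdiv_lt_0_compat; lra.
    - right; field; lra. }
  split; apply Rmult_le_reg_l with x; try assumption.
  + replace (x * (lnGamma x / x - (x + 1) * / y)) with (lnGamma x - x * ((x + 1) * / y))
      by (field; lra).
    replace (x * (ln y - p / x)) with (x * ln y - p) by (field; lra).
    nra.
  + replace (x * (lnGamma x / x)) with (lnGamma x) by (field; lra).
    replace (x * (ln y - p / x)) with (x * ln y - p) by (field; lra).
    lra.
- replace (Finite (lnGamma x / x)) with (Finite (lnGamma x / x - (x + 1) * 0))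
    by (f_equal; ring).
  apply is_lim_seq_minus'; [apply is_lim_seq_const|].
  apply (is_lim_seq_scal_l (fun n => / INR (S n)) (x + 1) 0).
  apply (is_lim_seq_incr_1 (fun n => / INR n) 0).
  apply (is_lim_seq_inv INR p_infty); [apply is_lim_seq_INR | discriminate].
- apply is_lim_seq_const.
Qed.

Lemma zeta_sum_limit (x : R) :
  3 <= x -> is_lim_seq (fun N => zeta_sum N x) (zeta x).
Proof.
intro Hx.
assert (E : forall N, zeta_sum N x = sum_n (fun n => 1 / Rpower (INR (S n)) x) N).
{ intro N. unfold zeta_sum. apply sum_n_ext. intro n. unfold Rpower.
  rewrite exp_Ropp. symmetry; apply Rmult_1_l. }
destruct (ex_finite_lim_seq_incr (fun N => zeta_sum N x) (5 / 4)) as [l Hl].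
- intro N. unfold zeta_sum. rewrite sum_n_S.
  assert (P := exp_pos (- (x * ln (INR (S (S N)))))). lra.
- intro N. apply Rle_trans with (sum_n (fun n => / INR (S n) ^ 3) N).
  + apply sum_n_le; intro n; apply zeta_term_le_cube; exact Hx.
  + apply Rle_trans with (1 := sum_cubes_le N). assert (P := pos_INR N).
    assert (0 < / (2 * (INR N + 1) * (INR N + 2)))
      by (apply Rinv_0_lt_compat; repeat apply Rmult_lt_0_compat; lra).
    lra.
- assert (S : is_series (fun n => 1 / Rpower (INR (S n)) x) l).
  { apply (is_lim_seq_ext _ _ _ E) in Hl. exact Hl. }
  unfold zeta. rewrite (is_series_unique _ _ S). exact Hl.
Qed.

(** * Concave approximants of ln theta *)

(** [log_product n] has n + 1 factors, so the index m + 2 guarantees the three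
    factors needed by [zeta_log_head], and pairs with ln (m + 3). *)
Definition approx (m : nat) (x : R) : R :=
  ln 2 / x + ln (zeta_sum m x) / x
  + (ln (INR (S (m + 2))) - log_product (m + 2) x / x).

(** The numbers of zeta terms and of factors are decoupled: at k = 0 this is
    [concave_on_zeta_log_head], and each further factor adds a concave
    function. *)
Lemma concave_on_approx (m : nat) : concave_on (fun x => 6 < x) (approx m).
Proof.
assert (H : forall N k, concave_on (fun x => 6 < x) (fun x =>
   ln 2 / x + ln (zeta_sum N x) / x - log_product (k + 2) x / x)).
{ intros N k. induction k as [|k IH].
  - apply concave_on_ext with (3 := concave_on_zeta_log_head N); [|intros; apply ray_convex; assumption].
    intros x Hx. unfold zeta_log_head, log_product. simpl (0 + 2)%nat.
    rewrite !sum_n_S, sum_O.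
    replace (INR 3) with 3 by (simpl; ring). replace (INR 2) with 2 by (simpl; ring).
    replace (INR 1) with 1 by (simpl; ring). field. lra.
  - assert (P : 0 < INR (S (S (k + 2)))) by (apply lt_0_INR; lia).
    assert (T := concave_on_log_factor _ P).
    apply concave_on_sub with (J := fun x => 6 < x) in T; [|intros; lra].
    apply concave_on_ext with (3 := concave_on_plus _ _ _ IH T);
      [|intros; apply ray_convex; assumption].
    intros x Hx. unfold log_product. simpl (S k + 2)%nat. rewrite sum_n_S.
    set (l := ln (1 + x / INR (S (S (k + 2))))). field. lra. }
intros x y t Hx Hy Ht. specialize (H m m x y t Hx Hy Ht). unfold approx. simpl in H |- *. lra.
Qed.

Lemma approx_limit (x : R) :
  6 < x -> is_lim_seq (fun m => approx m x) (ln (theta x)).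
Proof.
intro Hx.
assert (Z := zeta_sum_limit x ltac:(lra)).
assert (Z1 : 1 <= zeta x).
{ apply (is_lim_seq_le (fun _ => 1) (fun N => zeta_sum N x) 1 (zeta x)).
  - intro N; apply zeta_sum_ge_1.
  - apply is_lim_seq_const.
  - exact Z. }
destruct (Gamma_correct x ltac:(lra)) as [GP _].
replace (ln (theta x)) with (ln 2 / x + ln (zeta x) / x + lnGamma x / x).
2: { unfold theta, Rpower, lnGamma. rewrite ln_exp, !ln_mult by lra. field; lra. }
apply is_lim_seq_plus'.
- apply is_lim_seq_plus'; [apply is_lim_seq_const|].
  apply (is_lim_seq_scal_r _ (/ x) (ln (zeta x))).
  apply is_lim_seq_continuous; [|exact Z].
  apply continuity_pt_filterlim, continuous_ln. lra.
- apply (is_lim_seq_incr_n (fun n => ln (INR (S n)) - log_product n x / x) 2).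
  apply lnGamma_limit; lra.
Qed.

Theorem theorem2p4 : log_concave_on (fun x : R => 6 < x) theta.
Proof.
split.
- intros x _. apply exp_pos.
- apply concave_on_limit with (u := approx).
  + intros; apply ray_convex; assumption.
  + apply concave_on_approx.
  + apply approx_limit.
Qed.
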